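(* Let $(A,\{\cdot,\cdot,\cdot\})$ be a finite-dimensional real $3$-pre-Lie algebra with a symmetric and positive definite invariant bilinear form $\mathcal B$. Then $(A^c\ltimes_{L^*}A^*,\omega,-J)$ is a real Kähler $3$-Lie algebra, where for all $x,y\in A$, $\alpha,\beta\in A^*$, $$J(x+\alpha)=-(\mathcal B^\sharp)^{-1}(\alpha)+\mathcal B^\sharp(x),\qquad \omega(x+\alpha,y+\beta)=\langle\alpha,y\rangle-\langle\beta,x\rangle,$$ and $\mathcal B^\sharp:A\to A^*$ is given by $\langle\mathcal B^\sharp(x),y\rangle=\mathcal B(x,y)$.
   Context: A $3$-Lie algebra is a vector space with a trilinear skew-symmetric bracket satisfying $[x,y,[z,w,v]]=[[x,y,z],w,v]+[z,[x,y,w],v]+[z,w,[x,y,v]]$. A $3$-pre-Lie algebra is a vector space $A$ with a trilinear map $\{\cdot,\cdot,\cdot\}$ such that, with $[x,y,z]_C:=\{x,y,z\}+\{y,z,x\}+\{z,x,y\}$: (1) $\{x,y,z\}=-\{y,x,z\}$; (2) $\{x_1,x_2,\{x_3,x_4,x_5\}\}=\{[x_1,x_2,x_3]_C,x_4,x_5\}+\{x_3,[x_1,x_2,x_4]_C,x_5\}+\{x_3,x_4,\{x_1,x_2,x_5\}\}$; (3) $\{[x_1,x_2,x_3]_C,x_4,x_5\}=\{x_1,x_2,\{x_3,x_4,x_5\}\}+\{x_2,x_3,\{x_1,x_4,x_5\}\}+\{x_3,x_1,\{x_2,x_4,x_5\}\}$. $A^c=(A,[\cdot,\cdot,\cdot]_C)$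 is the sub-adjacent $3$-Lie algebra. Put $L(x,y)z=\{x,y,z\}$ and $\langle L^*(x,y)\alpha,z\rangle=-\langle\alpha,L(x,y)z\rangle$. The $3$-Lie algebra $A^c\ltimes_{L^*}A^*$ is $A\oplus A^*$ with bracket $[x_1+\alpha_1,x_2+\alpha_2,x_3+\alpha_3]_{L^*}=[x_1,x_2,x_3]_C+L^*(x_1,x_2)\alpha_3+L^*(x_2,x_3)\alpha_1+L^*(x_3,x_1)\alpha_2$. A bilinear form $\mathcal B$ on $A$ is invariant if $\mathcal B(\{x,y,z\},w)=-\mathcal B(z,\{x,y,w\})$ for all $x,y,z,w\in A$. A symplectic structure on a $3$-Lie algebra $\mathfrak g$ is a nondegenerate skew-symmetric bilinear form $\omega$ with $\omega([x,y,z],w)-\omega([y,z,w],x)+\omega([z,w,x],y)-\omega([w,x,y],z)=0$. A complex structure on $\mathfrak g$ is a linear map $K:\mathfrak g\to\mathfrak g$ with $K^2=-\mathrm{Id}$ and $K[x,y,z]=-[Kx,Ky,Kz]+[Kx,y,z]+[x,Ky,z]+[x,y,Kz]+K[Kx,Ky,z]+K[x,Ky,Kz]+K[Kx,y,Kz]$. A real pseudo-Kähler $3$-Lie algebra is a triple $(\mathfrak g,\omega,K)$, with $\mathfrak g$ a real $3$-Lie algebra, $\omega$ symplectic, $K$ a complex structure, and $\omega(Kx,Ky)=\omega(x,y)$ for all $x,y$. It is a real Kähler $3$-Lie algebra if in addition the symmetric bilinear form $S(x,y)=\omega(x,Ky)$ is positive definite. *)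

(* Defs.v *)
From HB Require Import structures.
From mathcomp Require Import all_boot all_order all_algebra.
From mathcomp Require Import reals.

Set Implicit Arguments.
Unset Strict Implicit.
Unset Printing Implicit Defensive.

Import Order.TTheory GRing.Theory Num.Theory.
Local Open Scope ring_scope.

Section TrilinearAndBilinear.
Variables (R : realType) (V : vectType R).

Definition trilinear (f : V -> V -> V -> V) : Prop :=
  [/\ forall y z, linear (fun x => f x y z),
      forall x z, linear (fun y => f x y z)
    & forall x y, linear (fun z => f x y z)].

Definition is_bilinear_form (b : V -> V -> R) : Prop :=
  bilinear_for *%R *%R b.

Definition is_symmetric_form (b : V -> V -> R) : Prop :=
  forall x y, b x y = b y x.

Definition is_skew_form (b : V -> V -> R) : Prop :=
  forall x y, b x y = - b y x.

Definition positive_definite (b : V -> V -> R) : Prop :=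
  forall x, x != 0 -> 0 < b x x.

(* For a skew-symmetric form the left and right radicals coincide. *)
Definition is_nondegenerate_form (b : V -> V -> R) : Prop :=
  forall x, (forall y, b x y = 0) -> x = 0.

End TrilinearAndBilinear.

Section ThreeLie.
Variables (R : realType) (g : vectType R).
Implicit Types (br : g -> g -> g -> g) (omega : g -> g -> R) (K : g -> g).

(* The two adjacent transpositions generate the symmetric group on 3 letters. *)
Definition skew3 br : Prop :=
  (forall x y z, br y x z = - br x y z) /\
  (forall x y z, br x z y = - br x y z).

Definition is_3Lie br : Prop :=
  [/\ trilinear br, skew3 br
    & forall x y z w v,
        br x y (br z w v) =
          br (br x y z) w v + br z (br x y w) v + br z w (br x y v)].

Definition is_symplectic3 br omega : Prop :=
  [/\ is_bilinear_form omega, is_skew_form omega, is_nondegenerate_form omega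
    & forall x y z w,
        omega (br x y z) w - omega (br y z w) x
          + omega (br z w x) y - omega (br w x y) z = 0].

Definition is_complex3 br K : Prop :=
  [/\ linear K, forall x, K (K x) = - x
    & forall x y z,
        K (br x y z) =
          - br (K x) (K y) (K z)
          + br (K x) y z + br x (K y) z + br x y (K z)
          + K (br (K x) (K y) z) + K (br x (K y) (K z))
          + K (br (K x) y (K z))].

Definition is_pseudo_Kahler3 br omega K : Prop :=
  [/\ is_3Lie br, is_symplectic3 br omega, is_complex3 br K
    & forall x y, omega (K x) (K y) = omega x y].

Definition Kahler_form omega K : g -> g -> R := fun x y => omega x (K y).

Definition is_Kahler3 br omega K : Prop :=
  is_pseudo_Kahler3 br omega K /\ positive_definite (Kahler_form omega K).

Lemma Kahler_form_bilinear br omega K :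
  is_pseudo_Kahler3 br omega K -> is_bilinear_form (Kahler_form omega K).
Proof.
case=> _ [[ol or] _ _ _] [Klin _ _] _; split=> [y | x] a u v.
  exact: ol.
by rewrite /Kahler_form Klin or.
Qed.

Lemma Kahler_form_sym br omega K :
  is_pseudo_Kahler3 br omega K -> is_symmetric_form (Kahler_form omega K).
Proof.
case=> _ [[ol or] sk _ _] [_ KK _] inv x y.
have o0 u : omega u 0 = 0.
  by have := or u (-1) 0 0; rewrite /= scaler0 addr0 mulN1r addNr.
have oN u v : omega u (- v) = - omega u v.
  by have := or u (-1) v 0; rewrite /= addr0 scaleN1r o0 addr0 mulN1r.
by rewrite /Kahler_form -(inv x) KK oN sk opprK.
Qed.

End ThreeLie.

Section ThreePreLie.
Variables (R : realType) (A : vectType R).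
Implicit Types (brace : A -> A -> A -> A) (B : A -> A -> R).

Definition commutator3 brace : A -> A -> A -> A :=
  fun x y z => brace x y z + brace y z x + brace z x y.

Definition is_3preLie brace : Prop :=
  let brC := commutator3 brace in
  [/\ trilinear brace,
      forall x y z, brace x y z = - brace y x z,
      forall x1 x2 x3 x4 x5,
        brace x1 x2 (brace x3 x4 x5) =
          brace (brC x1 x2 x3) x4 x5 + brace x3 (brC x1 x2 x4) x5
          + brace x3 x4 (brace x1 x2 x5)
    & forall x1 x2 x3 x4 x5,
        brace (brC x1 x2 x3) x4 x5 =
          brace x1 x2 (brace x3 x4 x5) + brace x2 x3 (brace x1 x4 x5)
          + brace x3 x1 (brace x2 x4 x5)].

Definition is_invariant_form brace B : Prop :=
  forall x y z w, B (brace x y z) w = - B z (brace x y w).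

Definition dual : vectType R := 'Hom(A, R^o).

Definition Lop brace (x y : A) : A -> A := fun z => brace x y z.

(* [linfun f] agrees with [f] only when [f] is linear: see LstarE and BsharpE. *)
Definition Lstar brace (x y : A) (alpha : dual) : dual :=
  linfun (fun z : A => (- alpha (Lop brace x y z)) : R^o).

Definition Bsharp B (x : A) : dual := linfun (fun y : A => B x y : R^o).

(* [f^-1%VF] is a two-sided inverse when [f] is bijective: see BsharpK and
   Bsharp_invK. *)
Definition Bsharp_inv B : dual -> A := (linfun (Bsharp B : A -> dual))^-1%VF.

Definition semidirect : vectType R := (A * dual)%type.

Definition semidirect_bracket brace (u1 u2 u3 : semidirect) : semidirect :=
  (commutator3 brace u1.1 u2.1 u3.1,
   Lstar brace u1.1 u2.1 u3.2 + Lstar brace u2.1 u3.1 u1.2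
     + Lstar brace u3.1 u1.1 u2.2).

Definition semidirect_omega (u v : semidirect) : R := u.2 v.1 - v.2 u.1.

Definition semidirect_J B (u : semidirect) : semidirect :=
  (- Bsharp_inv B u.2, Bsharp B u.1).

Lemma linfun_lin (U W : vectType R) (f : U -> W) :
  linear f -> linfun f =1 f.
Proof.
move=> flin x; pose F := HB.pack_for {linear U -> W} f
  (GRing.isLinear.Build R U W _ f flin).
exact: (lfunE F x).
Qed.

Lemma LstarE brace x y alpha z :
  trilinear brace -> Lstar brace x y alpha z = - alpha (brace x y z).
Proof.
case=> _ _ lin3; rewrite linfun_lin // => a u v.
by rewrite /Lop lin3 linearP opprD scalerN.
Qed.

Section Bsharp.
Variable B : A -> A -> R.
Hypotheses (Blin : is_bilinear_form B) (Bpos : positive_definite B).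

Lemma BsharpE x y : Bsharp B x y = B x y.
Proof. by rewrite linfun_lin // => a u v; rewrite Blin.2. Qed.

Lemma Bsharp_linear : linear (Bsharp B : A -> dual).
Proof.
move=> a u v; apply/lfunP => y.
by rewrite add_lfunE scale_lfunE !BsharpE Blin.1.
Qed.

Let Bs_ker : lker (linfun (Bsharp B : A -> dual)) == 0%VS.
Proof.
rewrite -subv0; apply/subvP => x.
rewrite memv_ker linfun_lin; last exact: Bsharp_linear.
move=> /eqP /lfunP /(_ x); rewrite BsharpE zero_lfunE => Bxx.
rewrite memv0; apply: contraT => /Bpos.
by rewrite Bxx ltxx.
Qed.

Lemma BsharpK : cancel (Bsharp B : A -> dual) (Bsharp_inv B).
Proof.
move=> x; rewrite -[X in Bsharp_inv B X]linfun_lin; last exact: Bsharp_linear.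
exact: lker0_lfunK.
Qed.

Lemma Bsharp_invK : cancel (Bsharp_inv B) (Bsharp B : A -> dual).
Proof.
move=> alpha; rewrite -linfun_lin; last exact: Bsharp_linear.
apply: limg_lfunVK.
suff -> : limg (linfun (Bsharp B : A -> dual)) = fullv by exact: memvf.
apply/eqP; rewrite eqEdim subvf /=.
have := limg_ker_dim (linfun (Bsharp B : A -> dual)) fullv.
rewrite (eqP Bs_ker) capv0 dimv0 add0n => ->.
by rewrite !dimvf; change (dim A * 1 <= dim A)%N; rewrite muln1.
Qed.

End Bsharp.

End ThreePreLie.

(* Main.v *)
Require Import Defs.
From mathcomp Require Import all_boot all_order all_algebra.
From mathcomp Require Import reals.
From mathcomp Require Import ring.

Set Implicit Arguments.
Unset Strict Implicit.
Unset Printing Implicit Defensive.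

Import Order.TTheory GRing.Theory Num.Theory.
Local Open Scope ring_scope.

(** Write an element of A + A* as (x, B# a), with x and a in A; positive
definiteness makes B# bijective, so every element has this form exactly once.
Invariance of B says that each L(x, y) is skew-adjoint, that is, that B#
intertwines L with L*.  In these coordinates
  [(x, a), (y, b), (z, c)] = ([x, y, z]_C, {x, y, c} + {y, z, a} + {z, x, b}),
  omega ((x, a), (y, b)) = B(a, y) - B(b, x),   and   - J (x, a) = (a, - x),
so S ((x, a), (x, a)) = B(a, a) + B(x, x) is positive unless x = a = 0, - J
preserves omega by symmetry of B, and the integrability identity of - J compares
two sums of braces that agree term by term ([paired_bracket],
[semidirect_is_complex]).

The bracket and omega involve only L*, and they form a symplectic 3-Lie
algebra for every 3-pre-Lie algebra.  The fundamental identity splits by the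
place of the component in A*.  With the functional in one of the last three
places it says that L* is compatible with the action of [x1, x2, -]
([Lstar_act]); with the functional in one of the first two places it is the
expansion of L*([x1, x2, x3], x4) ([Lstar_com]).  Both identities hold for L by
axioms (2) and (3).  The first passes to the dual because it equates a
commutator with L of something.  The second expresses L([x1, x2, x3], x4) by
products of two operators, whose order dualization reverses, so it needs
[brace_com_swap]: reversing all the products only changes the sign of the sum.

Identities between vectors are proved after applying an arbitrary linear
functional, which turns them into linear identities between real numbers. *)

(** * Testing identities on functionals *)

Section Functionals.
Variables (R : realType) (A : vectType R).
Implicit Types (x y : A) (f g : dual A).

(** The values are stated in [R], not in the regular module over it, so that
the resulting goals are ring identities in [R]. *)
Lemma dualD f x y : f (x + y) = (f x : R) + (f y : R) :> R.
Proof. by rewrite linearD. Qed.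

Lemma dualN f x : f (- x) = - (f x : R) :> R.
Proof. by rewrite linearN. Qed.

Lemma dualZ f a x : f (a *: x) = a * (f x : R) :> R.
Proof. by rewrite linearZ. Qed.

Definition dual_expand := (dualD, dualN, dualZ).

Lemma evalD f g x : (f + g) x = (f x : R) + (g x : R) :> R.
Proof. by rewrite add_lfunE. Qed.

Lemma evalN f x : (- f) x = - (f x : R) :> R.
Proof. by rewrite opp_lfunE. Qed.

Lemma evalZ f a x : (a *: f) x = a * (f x : R) :> R.
Proof. by rewrite scale_lfunE. Qed.

Definition eval_expand := (evalD, evalN, evalZ).

Lemma dual_separates x y : (forall f : dual A, f x = f y :> R) -> x = y.
Proof.
move=> fxy; rewrite (coord_vbasis (memvf x)) (coord_vbasis (memvf y)).
apply: eq_bigr => i _; congr (_ *: _).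
have := fxy (linfun (coord (vbasis fullv) i : A -> R^o)).
by rewrite !lfunE.
Qed.

Lemma dual_eval f g : (forall x, f x = g x :> R) -> f = g.
Proof. by move=> fg; apply/lfunP => x; exact: fg. Qed.

End Functionals.

(* Replacing the values of functionals by variables first keeps [ring] from
   unfolding the matrices behind them when it compares two of them. *)
Ltac dual_ring :=
  repeat match goal with
  | |- context [@fun_of_lfun ?F ?U ?V ?f ?x] =>
      let r := fresh "r" in generalize (@fun_of_lfun F U V f x) => r
  end; ring.

(** * Trilinear maps *)

Section Trilinear.
Variables (R : realType) (A : vectType R) (f : A -> A -> A -> A).
Hypothesis f_lin : trilinear f.

Let lin_expand (h : A -> A) :
  linear h -> (forall x y, h (x + y) = h x + h y) * (forall x, h (- x) = - h x).
Proof.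
move=> hlin; have h0 : h 0 = 0.
  by have := hlin (-1) 0 0; rewrite !scaleN1r !addNr.
split=> [x y | x]; first by rewrite -[x]scale1r hlin !scale1r.
by have := hlin (-1) x 0; rewrite h0 !addr0 !scaleN1r.
Qed.

Lemma trilinearD1 x x' y z : f (x + x') y z = f x y z + f x' y z.
Proof. by case: f_lin => l _ _; rewrite (lin_expand (l y z)). Qed.
Lemma trilinearN1 x y z : f (- x) y z = - f x y z.
Proof. by case: f_lin => l _ _; rewrite (lin_expand (l y z)). Qed.
Lemma trilinearD2 x y y' z : f x (y + y') z = f x y z + f x y' z.
Proof. by case: f_lin => _ l _; rewrite (lin_expand (l x z)). Qed.
Lemma trilinearN2 x y z : f x (- y) z = - f x y z.
Proof. by case: f_lin => _ l _; rewrite (lin_expand (l x z)). Qed.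
Lemma trilinearD3 x y z z' : f x y (z + z') = f x y z + f x y z'.
Proof. by case: f_lin => _ _ l; rewrite (lin_expand (l x y)). Qed.
Lemma trilinearN3 x y z : f x y (- z) = - f x y z.
Proof. by case: f_lin => _ _ l; rewrite (lin_expand (l x y)). Qed.

Definition trilinear_expand :=
  (trilinearD1, trilinearD2, trilinearD3,
   trilinearN1, trilinearN2, trilinearN3).

End Trilinear.

(** * The symplectic 3-Lie algebra of a 3-pre-Lie algebra *)

Section PreLie.
Variables (R : realType) (A : vectType R) (brace : A -> A -> A -> A).
Hypothesis preLie : is_3preLie brace.

Notation "{ x , y , z }" := (brace x y z).
Notation "[< x , y , z >]" := (commutator3 brace x y z).
Notation Ls := (Lstar brace).
Notation sbr := (semidirect_bracket brace).

Let tri : trilinear brace. Proof. by case: preLie. Qed.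
Let skew x y z : {x, y, z} = - {y, x, z}. Proof. by case: preLie. Qed.
Let act x1 x2 x3 x4 v : {x1, x2, {x3, x4, v}} =
  {[<x1, x2, x3>], x4, v} + {x3, [<x1, x2, x4>], v} + {x3, x4, {x1, x2, v}}.
Proof. by case: preLie. Qed.
Let com x1 x2 x3 x4 v : {[<x1, x2, x3>], x4, v} =
  {x1, x2, {x3, x4, v}} + {x2, x3, {x1, x4, v}} + {x3, x1, {x2, x4, v}}.
Proof. by case: preLie. Qed.

Lemma commutator3_trilinear : trilinear (commutator3 brace).
Proof.
case: tri => l1 l2 l3; split=> [y z | x z | x y] a u v /=;
  apply: dual_separates => f; rewrite /commutator3 l1 l2 l3;
  rewrite !dual_expand; dual_ring.
Qed.

Lemma commutator3_skew : skew3 (commutator3 brace).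
Proof.
split=> x y z; apply: dual_separates => f; rewrite /commutator3.
  by rewrite (skew y x) (skew x z) (skew z y) !dual_expand; dual_ring.
by rewrite (skew x z) (skew z y) (skew y x) !dual_expand; dual_ring.
Qed.

Lemma commutator3E x y z : [<x, y, z>] = {x, y, z} + {y, z, x} + {z, x, y}.
Proof. by []. Qed.

Lemma brace_commutator3 x y z w v :
  {x, y, [<z, w, v>]} =
  {x, y, {z, w, v}} + {x, y, {w, v, z}} + {x, y, {v, z, w}}.
Proof. by rewrite commutator3E !(trilinear_expand tri). Qed.

(** Expand the outer commutators.  The terms with a commutator in one of the
first two places of a brace match by axiom (2), applied to x, y and the three
cyclic orders of z, w, v.  What remains are nested braces with x, y and one of
z, w, v inside: those with x, y in front of the third also come from axiom (2),
the others from axiom (3) applied to the braces that start with [z, w, v]. *)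
Lemma commutator3_is_3Lie : is_3Lie (commutator3 brace).
Proof.
split; [exact: commutator3_trilinear | exact: commutator3_skew |].
move=> x y z w v; apply: dual_separates => f.
rewrite (commutator3E x y [<z, w, v>]) (commutator3E [<x, y, z>]).
rewrite (commutator3E z [<x, y, w>]) (commutator3E z w [<x, y, v>]).
rewrite !brace_commutator3 (act x y z w v) (act x y w v z) (act x y v z w).
rewrite (skew y [<z, w, v>]) (com z w v y x) (com z w v x y).
rewrite (skew y v) (skew y z) (skew y w) !(trilinear_expand tri).
by rewrite !dual_expand; dual_ring.
Qed.

Lemma evalLstar x y (a : dual A) z : Ls x y a z = - (a {x, y, z} : R) :> R.
Proof. exact: LstarE. Qed.

Lemma LstarD x y (a b : dual A) : Ls x y (a + b) = Ls x y a + Ls x y b.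
Proof.
by apply: dual_eval => z; rewrite evalD !evalLstar evalD; dual_ring.
Qed.

Lemma LstarN x y (a : dual A) : Ls x y (- a) = - Ls x y a.
Proof.
by apply: dual_eval => z; rewrite evalN !evalLstar evalN.
Qed.

Lemma Lstar_skew x y a : Ls x y a = - Ls y x a.
Proof.
by apply: dual_eval => z; rewrite evalN !evalLstar skew dualN.
Qed.

Lemma Lstar_act x1 x2 x3 x4 a : Ls x1 x2 (Ls x3 x4 a) =
  Ls [<x1, x2, x3>] x4 a + Ls x3 [<x1, x2, x4>] a + Ls x3 x4 (Ls x1 x2 a).
Proof.
apply: dual_eval => z; rewrite !evalD !evalLstar (act x1 x2 x3 x4 z).
by rewrite !dual_expand; dual_ring.
Qed.

(** Axiom (3) computes both L([x1, x2, x3], x4) and L(x3, [x1, x2, x4]) as sums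
of products; substituting these into axiom (2) leaves a relation among products
only, which says that the right side of (3) changes sign when every product is
taken in the opposite order. *)
Lemma brace_com_swap x1 x2 x3 x4 v :
  {x1, x2, {x3, x4, v}} + {x2, x3, {x1, x4, v}} + {x3, x1, {x2, x4, v}} =
  - ({x3, x4, {x1, x2, v}} + {x1, x4, {x2, x3, v}} + {x2, x4, {x3, x1, v}}).
Proof.
have := act x1 x2 x3 x4 v.
rewrite (skew x3 [<x1, x2, x4>]) (com x1 x2 x3) (com x1 x2 x4).
rewrite (skew x4 x1) (skew x4 x3) (skew x1 x3 v) !(trilinear_expand tri) => e.
apply: dual_separates => f; have /(congr1 (fun w => f w : R)) := e.
(* The difference of the sides of [e], right minus left, is the difference of
   the sides of the goal. *)
rewrite !dual_expand => /esym/eqP; rewrite -subr_eq0 => /eqP {}e.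
by apply/eqP; rewrite -subr_eq0 -[X in _ == X]e; apply/eqP; dual_ring.
Qed.

(** Dualizing L changes the sign of L([x1, x2, x3], x4) and reverses the
products, whose two signs cancel; [brace_com_swap] makes up
for the one that is left. *)
Lemma Lstar_com x1 x2 x3 x4 a : Ls [<x1, x2, x3>] x4 a =
  Ls x1 x2 (Ls x3 x4 a) + Ls x2 x3 (Ls x1 x4 a) + Ls x3 x1 (Ls x2 x4 a).
Proof.
apply: dual_eval => z; rewrite !evalD !evalLstar com brace_com_swap.
by rewrite !dual_expand; dual_ring.
Qed.

Lemma semidirect_trilinear : trilinear sbr.
Proof.
have [c1 c2 c3] := commutator3_trilinear; have [l1 l2 l3] := tri.
split=> -[x a] [y b] k [z c] [w d]; congr (_, _) => /=;
  rewrite ?c1 ?c2 ?c3 //; apply: dual_eval => t.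
  all: rewrite !(evalD, evalZ, evalLstar).
  all: by rewrite ?l1 ?l2 !dual_expand; dual_ring.
Qed.

Lemma semidirect_skew : skew3 sbr.
Proof.
have [s12 s23] := commutator3_skew.
split=> -[x a] [y b] [z c].
  congr (_, _) => /=; first exact: s12.
  rewrite (Lstar_skew y x) (Lstar_skew x z) (Lstar_skew z y).
  by apply: dual_eval => t; rewrite !eval_expand; dual_ring.
congr (_, _) => /=; first exact: s23.
rewrite (Lstar_skew x z) (Lstar_skew z y) (Lstar_skew y x).
by apply: dual_eval => t; rewrite !eval_expand; dual_ring.
Qed.

Lemma semidirect_is_3Lie : is_3Lie sbr.
Proof.
split; [exact: semidirect_trilinear | exact: semidirect_skew |].
case=> x1 a1 [x2 a2] [x3 a3] [x4 a4] [x5 a5]; congr (_, _) => /=.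
  by have [_ _ ->] := commutator3_is_3Lie.
(* [Lstar_act] settles the components a3, a4 and a5; the components a1 and a2
   reduce to [Lstar_com] for x3, x4, x5. *)
rewrite !LstarD (Lstar_act x1 x2 x3 x4) (Lstar_act x1 x2 x4 x5).
rewrite (Lstar_act x1 x2 x5 x3) (Lstar_skew x2 [<x3, x4, x5>]).
rewrite (Lstar_com x3 x4 x5 x2) (Lstar_com x3 x4 x5 x1).
rewrite (Lstar_skew x5 x2) (Lstar_skew x3 x2) (Lstar_skew x4 x2) !LstarN.
by apply: dual_eval => t; rewrite !eval_expand; dual_ring.
Qed.

(** Each functional pairs once with the whole commutator of the other three
entries and once with each of the three braces that make up that commutator,
so the closedness identity cancels functional by functional. *)
Lemma semidirect_is_symplectic : is_symplectic3 sbr (@semidirect_omega R A).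
Proof.
split.
- by split=> [v | u] k s t; rewrite /semidirect_omega /=;
    rewrite ?eval_expand ?dual_expand; dual_ring.
- by move=> u v; rewrite /semidirect_omega; dual_ring.
- case=> x a xa0; suff [-> ->] : x = 0 /\ a = 0 by [].
  split; first apply: dual_separates => f; last apply: dual_eval => y.
    have dual0 (g : dual A) : g 0 = 0 :> R by rewrite linear0.
    have /eqP := xa0 (0, f); rewrite /semidirect_omega /= !dual0 sub0r.
    by rewrite oppr_eq0 => /eqP.
  have := xa0 (y, 0); rewrite /semidirect_omega /= zero_lfunE subr0 => ->.
  by rewrite zero_lfunE.
case=> x a [y b] [z c] [w d]; rewrite /semidirect_omega /=.
rewrite !evalD !evalLstar /commutator3 !(skew w y) !(skew z x).
by rewrite !dual_expand; dual_ring.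
Qed.

End PreLie.

(** * The complex structure of an invariant positive definite form *)

Section InvariantForm.
Variables (R : realType) (A : vectType R).
Variables (brace : A -> A -> A -> A) (B : A -> A -> R).
Hypotheses (preLie : is_3preLie brace) (B_bilinear : is_bilinear_form B).
Hypotheses (B_symmetric : is_symmetric_form B) (B_posdef : positive_definite B).
Hypothesis B_invariant : is_invariant_form brace B.

Notation "{ x , y , z }" := (brace x y z).
Notation "[< x , y , z >]" := (commutator3 brace x y z).
Notation sbr := (semidirect_bracket brace).
Notation B' := (Bsharp B).
Notation K := (fun u : semidirect A => - semidirect_J B u).

Let tri : trilinear brace. Proof. by case: preLie. Qed.

(** The coordinates (x, a) in which - J is the rotation (x, a) |-> (a, - x). *)
Definition paired x a : semidirect A := (x, B' a).

Lemma paired_surj u : exists x a, u = paired x a.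
Proof.
by case: u => x al; exists x, (Bsharp_inv B al); rewrite /paired Bsharp_invK.
Qed.

Let Bsharp_lin x : B' x = linfun (B' : A -> dual A) x.
Proof. by rewrite linfun_lin //; exact: Bsharp_linear. Qed.

Lemma BsharpD a b : B' (a + b) = B' a + B' b.
Proof. by rewrite !Bsharp_lin linearD. Qed.

Lemma BsharpN a : B' (- a) = - B' a.
Proof. by rewrite !Bsharp_lin linearN. Qed.

Lemma BsharpZ k a : B' (k *: a) = k *: B' a.
Proof. by rewrite !Bsharp_lin linearZ. Qed.

Lemma pairedD x y a b : paired x a + paired y b = paired (x + y) (a + b).
Proof. by rewrite /paired BsharpD. Qed.

Lemma pairedN x a : - paired x a = paired (- x) (- a).
Proof. by rewrite /paired BsharpN. Qed.

Lemma pairedZ k x a : k *: paired x a = paired (k *: x) (k *: a).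
Proof. by rewrite /paired BsharpZ. Qed.

Lemma paired_J x a : - semidirect_J B (paired x a) = paired a (- x).
Proof.
rewrite /semidirect_J /= BsharpK // /paired BsharpN.
by congr (_, _); rewrite /= opprK.
Qed.

(** This is what invariance of [B] means: L(x, y) is skew-adjoint, so [B']
identifies L* with L. *)
Lemma Lstar_Bsharp x y a : Lstar brace x y (B' a) = B' {x, y, a}.
Proof.
by apply: dual_eval => z; rewrite evalLstar // !BsharpE // B_invariant.
Qed.

Lemma paired_bracket x y z a b c :
  sbr (paired x a) (paired y b) (paired z c) =
  paired [<x, y, z>] ({x, y, c} + {y, z, a} + {z, x, b}).
Proof.
rewrite /semidirect_bracket /= !Lstar_Bsharp.
by rewrite /paired !BsharpD.
Qed.

Lemma paired_omega x y a b :
  semidirect_omega (paired x a) (paired y b) = B a y - B b x.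
Proof. by rewrite /semidirect_omega /= !BsharpE. Qed.

(** In the coordinates [paired] every entry of the integrability identity is a
sum of braces of the x's and a's.  In the A-part of the right side the braces of
three a's cancel between [Ku, Kv, Kw] and the terms under K, and of those with
one a only the three with a in last place survive; in the dual part the braces
with two a's cancel, which leaves - [x, y, z]_C.  This is the left side. *)
Lemma semidirect_is_complex : is_complex3 sbr K.
Proof.
split=> [k u v | u | u v w].
- have [x [a ->]] := paired_surj u; have [y [b ->]] := paired_surj v.
  by rewrite pairedZ pairedD !paired_J pairedZ pairedD scalerN opprD.
- by have [x [a ->]] := paired_surj u; rewrite !paired_J pairedN.
have [x [a ->]] := paired_surj u; have [y [b ->]] := paired_surj v.
have [z [c ->]] := paired_surj w.
rewrite !paired_J !paired_bracket !paired_J !pairedN !pairedD.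
congr paired; apply: dual_separates => f;
  by rewrite /commutator3 !(trilinear_expand tri) !dual_expand; dual_ring.
Qed.

Lemma semidirect_is_Kahler : is_Kahler3 sbr (@semidirect_omega R A) K.
Proof.
have BN x y : B (- x) y = - B x y.
  by rewrite -!BsharpE // BsharpN evalN.
split.
  split; [exact: semidirect_is_3Lie | exact: semidirect_is_symplectic
         | exact: semidirect_is_complex | move=> u v].
  have [x [a ->]] := paired_surj u; have [y [b ->]] := paired_surj v.
  rewrite !paired_J !paired_omega !BN (B_symmetric x) (B_symmetric y).
  by ring.
move=> u; have [x [a ->]] := paired_surj u => nz.
rewrite /Kahler_form paired_J paired_omega BN opprK.
have B_ge0 y : 0 <= B y y.
  have [->|/B_posdef /ltW //] := eqVneq y 0.
  by rewrite -BsharpE // linear0.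
have [a0 | a_nz] := eqVneq a 0; last by rewrite ltr_wpDr // B_posdef.
rewrite ltr_wpDl // B_posdef //; apply: contraNneq nz => ->.
by rewrite a0 /paired Bsharp_lin linear0.
Qed.

End InvariantForm.

Theorem proposition9p7 (R : realType) (A : vectType R)
    (brace : A -> A -> A -> A) (B : A -> A -> R)
    (brace_preLie : is_3preLie brace)
    (B_bilinear : is_bilinear_form B)
    (B_symmetric : is_symmetric_form B)
    (B_posdef : positive_definite B)
    (B_invariant : is_invariant_form brace B) :
  is_Kahler3 (semidirect_bracket brace) (@semidirect_omega R A)
    (fun u => - semidirect_J B u).
Proof. exact: semidirect_is_Kahler. Qed.
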